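(* Let $\mathcal F\subset\mathcal U$ be the subset of classes of representations $\rho\colon\mathbb Z^2\to\mathrm{Heis}_0$ whose extension $\widehat\rho\colon\mathbb R^2\to\mathrm{Heis}_0$ acts freely on the plane $\mathbb A^2$. Then $\mathcal F$ is a trivial $\mathbb R^\times$-bundle over the cylinder $T^2\smallsetminus S$, where $S$ is the circle given by the intersection of the torus $T^2=V(x_1y_2-x_2y_1)\cap\mathbb S^3$ with the plane $V(y_1,y_2)=\{y_1=y_2=0\}$.
   Context: $\mathrm{Heis}_0$ is the group of upper triangular unipotent real $3\times3$ matrices acting on $\mathbb A^2=\{[x:y:1]\}\subset\mathbb{RP}^2$. A representation $\rho\colon\mathbb Z^2\to\mathrm{Heis}_0$ has Lie algebra coordinates $(\vec x,\vec y,\vec z)\in\mathbb R^6$ defined by $$\log\rho(e_i)=\begin{pmatrix}0&x_i&z_i\\0&0&y_i\\0&0&0\end{pmatrix},\quad i=1,2;$$ commutation is the condition $x_1y_2=x_2y_1$. Every $\rho$ extends uniquely to $\widehat\rho\colon\mathbb R^2\to\mathrm{Heis}_0$, $\widehat\rho(s,t)=\rho(e_1)^s\rho(e_2)^t$, with $A^s=\exp(s\log A)$. $\mathcal U$ is the quotient of $\mathrm{Hom}(\mathbb Z^2,\mathrm{Heis}_0)$ by $\mathrm{Heis}_0$-conjugation and by the $\mathbb R_+$-action $t\cdot(\vec x,\vec y,\vec z)=(t\vec x,t\vec y,t\vec z)$. The subset $\mathcal U^\star\subset\mathcal U$ of classes of representations with image not in the center (i.e. $(\vec x,\vec y)\ne0$)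 is identified with $$\{(\vec x,\vec y,\vec z)\in\mathbb R^6: \|\vec x\|^2+\|\vec y\|^2=1,\ x_1y_2-x_2y_1=0,\ \vec z\cdot\vec x=\vec z\cdot\vec y=0\},$$ each class being represented by its unique representative of this form; the projection $(\vec x,\vec y,\vec z)\mapsto(\vec x,\vec y)$ makes it a real line bundle over the torus $T^2=\{(\vec x,\vec y): x_1y_2=x_2y_1,\ \|\vec x\|^2+\|\vec y\|^2=1\}\subset\mathbb S^3\subset\mathbb R^4$. The bundle projection of $\mathcal F$ is the restriction of this projection. $\mathbb R^\times=\mathbb R\smallsetminus\{0\}$. *)

(* Defs.v *)
From HB Require Import structures.
From mathcomp Require Import all_boot all_order all_algebra generic_quotient.
From mathcomp Require Import all_classical all_reals topology normedtype.

Set Implicit Arguments.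
Unset Strict Implicit.
Unset Printing Implicit Defensive.

Import Order.TTheory GRing.Theory Num.Theory.
Import numFieldNormedType.Exports.

Local Open Scope classical_set_scope.
Local Open Scope ring_scope.
Local Open Scope quotient_scope.

Section Topology.

Definition homeomorphism (X Y : topologicalType) (f : X -> Y) : Prop :=
  continuous f /\
  exists g : Y -> X, [/\ continuous g, cancel f g & cancel g f].

Definition homeomorphic (X Y : topologicalType) : Prop :=
  exists f : X -> Y, homeomorphism f.

(* [F], [B] and [A] carry their subspace topologies.  Only the restriction of
   [pr] to [F] matters, and its continuity follows from the existence of the
   trivialization [phi]. *)
Definition trivial_bundle (E X Y : topologicalType)
    (F : set E) (pr : E -> X) (B : set X) (A : set Y) : Prop :=
  exists phi : F -> (B * A)%type,
    homeomorphism phi /\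
    forall p : F, set_val (phi p).1 = pr (set_val p).

End Topology.

Section Heisenberg.
Variable R : realType.

Definition Heis0 : set 'M[R]_3 :=
  [set A | forall i j : 'I_3, ((j < i)%N -> A i j = 0) /\ A i i = 1].

Definition Heis0_center : set 'M[R]_3 :=
  [set A | Heis0 A /\ forall B, Heis0 B -> A * B = B * A].

(* The exponential and logarithm series, cut at the third power: this is exact
   for N strictly upper triangular, resp. A in Heis0, as then N^3 = 0, resp.
   (A - 1)^3 = 0. *)
Definition mxexp (N : 'M[R]_3) : 'M[R]_3 :=
  \sum_(0 <= k < 3) (k`!%:R^-1 : R) *: N ^+ k.

Definition mxlog (A : 'M[R]_3) : 'M[R]_3 :=
  \sum_(1 <= k < 3) ((-1) ^+ k.+1 / k%:R : R) *: (A - 1) ^+ k.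

Definition mxpow (A : 'M[R]_3) (s : R) : 'M[R]_3 := mxexp (s *: mxlog A).

(* Hom(Z^2, Heis_0), with the topology of pointwise convergence. *)
Definition HomZ2 : set {ptws (int * int)%type -> 'M[R]_3} :=
  [set rho | [/\ forall a, Heis0 (rho a), rho 0 = 1 &
                 forall a b, rho (a + b) = rho a * rho b]].

(* Indices are shifted by one: [e2 0], [e2 1] are the generators e_1, e_2, and
   likewise the entries 0, 1 of a vector in R^2 are its coordinates 1, 2. *)
Definition e2 (i : 'I_2) : int * int := if i == 0 then (1, 0) else (0, 1).

(* ((x, y), z) in R^6. *)
Definition R6 : Type := ('rV[R]_2 * 'rV[R]_2 * 'rV[R]_2)%type.

Definition coords (rho : int * int -> 'M[R]_3) : R6 :=
  (\row_i mxlog (rho (e2 i)) 0 1,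
   \row_i mxlog (rho (e2 i)) 1 2%:R,
   \row_i mxlog (rho (e2 i)) 0 2%:R).

Definition conj_rep (h : 'M[R]_3) (rho : int * int -> 'M[R]_3) :
    int * int -> 'M[R]_3 :=
  fun a => h * rho a * h^-1.

Definition same_orbit (rho1 rho2 : HomZ2) : Prop :=
  exists h t, [/\ Heis0 h, 0 < t &
    coords (set_val rho2) = t *: coords (conj_rep h (set_val rho1))].

(* [upper k A]: the entries of A below the k-th superdiagonal vanish. *)
Definition upper (k : nat) (A : 'M[R]_3) : Prop :=
  forall i j : 'I_3, (j < i + k)%N -> A i j = 0.

Lemma upperM k l A B : upper k A -> upper l B -> upper (k + l) (A * B).
Proof.
move=> kA lB i j lt_j; rewrite mxE big1// => m _.
have [/kA->|le_m] := ltnP m (i + k); first by rewrite mul0r.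
by rewrite lB ?mulr0// (leq_trans lt_j)// addnA leq_add2r.
Qed.

Lemma upperD k A B : upper k A -> upper k B -> upper k (A + B).
Proof. by move=> kA kB i j ij; rewrite mxE kA// kB// addr0. Qed.

Lemma upperZ k c A : upper k A -> upper k (c *: A).
Proof. by move=> kA i j ij; rewrite mxE kA// mulr0. Qed.

Lemma upperW k l A : (l <= k)%N -> upper k A -> upper l A.
Proof. by move=> lk kA i j ij; rewrite kA// (leq_trans ij)// leq_add2l. Qed.

Lemma upper3 A : upper 3 A -> A = 0.
Proof.
move=> A3; apply/matrixP => i j; rewrite A3 ?mxE//.
by rewrite (leq_trans (ltn_ord j))// leq_addl.
Qed.

Lemma upper0_1 : upper 0 1.
Proof.
move=> i j; rewrite addn0 => ij; rewrite mxE.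
by case: eqP ij => // ->; rewrite ltnn.
Qed.

Lemma Heis0P A : Heis0 A <-> upper 1 (A - 1).
Proof.
split=> [hA i j|hA i j].
  rewrite addn1 ltnS leq_eqVlt => /orP[/eqP/val_inj->|ji].
    by rewrite !mxE eqxx (hA i i).2 subrr.
  rewrite !mxE (hA i j).1// (_ : i == j = false) ?subr0//.
  by apply/eqP => ij; rewrite ij ltnn in ji.
split=> [ji|].
  have := hA i j; rewrite !mxE addn1 ltnS => /(_ (ltnW ji)).
  rewrite (_ : i == j = false) ?subr0//.
  by apply/eqP => ij; rewrite ij ltnn in ji.
by have := hA i i; rewrite !mxE addn1 ltnS leqnn eqxx => /(_ isT)/subr0_eq.
Qed.

Lemma Heis0_upper0 A : Heis0 A -> upper 0 A.
Proof.
by move=> /Heis0P/(@upperW _ 0 _ isT) A1; rewrite -(subrK 1 A); exact: upperD upper0_1.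
Qed.

Lemma Heis0_1 : Heis0 1.
Proof. by apply/Heis0P => i j _; rewrite subrr mxE. Qed.

Lemma Heis0M A B : Heis0 A -> Heis0 B -> Heis0 (A * B).
Proof.
move=> hA hB; apply/Heis0P.
have -> : A * B - 1 = (A - 1) * B + (B - 1).
  by rewrite mulrBl mul1r addrA subrK.
apply: upperD; last exact/Heis0P.
by apply: (@upperM 1 0); [exact/Heis0P|exact: Heis0_upper0].
Qed.

Lemma Heis0_inv A : Heis0 A -> A \is a GRing.unit /\ Heis0 A^-1.
Proof.
move=> /Heis0P; set N := A - 1 => N1.
have N2 : upper 2 (N * N) by exact: (@upperM 1 1).
have N3 : N * N * N = 0 by apply: upper3; exact: (@upperM 2 1).
have eA : A = 1 + N by rewrite /N addrC subrK.
clearbody N; pose B := 1 - N + N * N.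
have BA : B * A = 1.
  rewrite eA mulrDr mulr1 /B !(mulrDl _ _ N) mul1r mulNr N3 addr0.
  by rewrite [N - _]addrC addrA addrK subrK.
have uA : A \is a GRing.unit.
  have : B *m A = 1%:M by [].
  by case/mulmx1_unit.
split=> //.
have -> : A^-1 = B by apply: (mulIr uA); rewrite mulVr.
apply/Heis0P; rewrite /B (_ : 1 - N + N * N - 1 = N * N + (-1) *: N).
  by apply: upperD; [exact: upperW N2|exact: upperZ].
by rewrite scaleN1r addrAC [1 - N]addrC addrK addrC.
Qed.

Lemma mxlogE A : mxlog A = (A - 1) - 2%:R^-1 *: ((A - 1) * (A - 1)).
Proof.
rewrite /mxlog big_nat_recr// big_nat1/= expr1 -expr2.
by rewrite -[(-1) ^+ 3]signr_odd sqrrN expr1n divr1 scale1r expr1 mulN1r scaleNr.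
Qed.

Lemma mxlog_upper A : Heis0 A -> upper 1 (mxlog A).
Proof.
move=> /Heis0P A1; rewrite mxlogE -scaleNr.
by apply: upperD => //; apply: upperZ; apply: (@upperW 2) => //; exact: (@upperM 1 1).
Qed.

Lemma mxlogJ h A : h \is a GRing.unit ->
  mxlog (h * A * h^-1) = h * mxlog A * h^-1.
Proof.
move=> uh; rewrite !mxlogE.
have -> : h * A * h^-1 - 1 = h * (A - 1) * h^-1.
  by rewrite mulrBr mulr1 mulrBl divrr.
move: (A - 1) => N; rewrite mulrBr mulrBl -scalerAr -scalerAl; congr (_ - _ *: _).
by rewrite !mulrA mulrVK.
Qed.

Lemma upper1_eq A B : upper 1 A -> upper 1 B ->
  A 0 1 = B 0 1 -> A 1 2%:R = B 1 2%:R -> A 0 2%:R = B 0 2%:R -> A = B.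
Proof.
move=> hA hB e01 e12 e02; apply/matrixP => i j.
have [ij|] := ltnP j (i + 1); first by rewrite hA// hB.
case: i => -[|[|[|//]]] hi; case: j => -[|[|[|//]]] hj // _.
- by rewrite (_ : Ordinal hi = 0) 1?(_ : Ordinal hj = 1) //; exact: val_inj.
- by rewrite (_ : Ordinal hi = 0) 1?(_ : Ordinal hj = 2%:R) //; exact: val_inj.
- by rewrite (_ : Ordinal hi = 1) 1?(_ : Ordinal hj = 2%:R) //; exact: val_inj.
Qed.

Lemma Hom_Heis0 (rho : HomZ2) a : Heis0 (set_val rho a).
Proof. by case: rho => f /=; rewrite set_valE /= => /set_mem[]. Qed.

Lemma same_orbitP (rho1 rho2 : HomZ2) : same_orbit rho1 rho2 <->
  exists h t, [/\ Heis0 h, 0 < t & forall i,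
    mxlog (set_val rho2 (e2 i)) = t *: (h * mxlog (set_val rho1 (e2 i)) * h^-1)].
Proof.
split=> -[h [t [hh t0 e]]]; have [uh hV] := Heis0_inv hh; exists h, t; split=> //.
  move=> i; case: e => /rowP/(_ i) + /rowP/(_ i) + /rowP/(_ i).
  rewrite /conj_rep !mxE mxlogJ// => ex ey ez.
  apply: upper1_eq; [exact/mxlog_upper/Hom_Heis0| |by rewrite mxE..].
  apply: upperZ; apply: (@upperM 1 0); last exact: Heis0_upper0.
  by apply: (@upperM 0 1); [exact: Heis0_upper0|exact/mxlog_upper/Hom_Heis0].
have R6_eq (c d : R6) : c.1.1 = d.1.1 -> c.1.2 = d.1.2 -> c.2 = d.2 -> c = d.
  by case: c d => -[? ?] ? [[? ?] ?] /= -> -> ->.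
by apply: R6_eq; apply/rowP => i; rewrite /= !mxE mxlogJ// e mxE.
Qed.

Definition same_orbitb : rel HomZ2 := fun rho1 rho2 => `[< same_orbit rho1 rho2 >].

Lemma same_orbit_refl : reflexive same_orbitb.
Proof.
move=> rho; apply/asboolP/same_orbitP; exists 1, 1; split=> //.
  exact: Heis0_1.
by move=> i; rewrite scale1r mul1r invr1 mulr1.
Qed.

Lemma same_orbit_imp (rho1 rho2 : HomZ2) :
  same_orbit rho1 rho2 -> same_orbit rho2 rho1.
Proof.
move=> /same_orbitP[h [t [hh t0 e]]]; apply/same_orbitP.
have [uh hV] := Heis0_inv hh.
exists h^-1, t^-1; split=> //; first by rewrite invr_gt0.
move=> i; rewrite e invrK -scalerAr -scalerAl scalerA mulVf ?gt_eqF// scale1r.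
by rewrite !mulrA mulVr// mul1r mulrVK.
Qed.

Lemma same_orbit_sym : symmetric same_orbitb.
Proof.
by move=> rho1 rho2; apply/asboolP/asboolP; exact: same_orbit_imp.
Qed.

Lemma same_orbit_trans : transitive same_orbitb.
Proof.
move=> rho2 rho1 rho3 /asboolP/same_orbitP[h [t [hh t0 e]]].
move=> /asboolP/same_orbitP[k [u [hk u0 f]]]; apply/asboolP/same_orbitP.
have [uh hV] := Heis0_inv hh; have [uk kV] := Heis0_inv hk.
exists (k * h), (u * t); split; [exact: Heis0M|exact: mulr_gt0|move=> i].
by rewrite f e -scalerAr -scalerAl scalerA invrM// !mulrA.
Qed.

Canonical same_orbit_equiv :=
  EquivRel same_orbitb same_orbit_refl same_orbit_sym same_orbit_trans.

Definition U : topologicalType :=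
  quotient_topology {eq_quot same_orbit_equiv}.

Definition classU (rho : HomZ2) : U := \pi_{eq_quot same_orbit_equiv} rho.

Definition Ustar : set U :=
  classU @` [set rho : HomZ2 | exists a, ~ Heis0_center (set_val rho a)].

Definition rho_hat (rho : int * int -> 'M[R]_3) (s t : R) : 'M[R]_3 :=
  mxpow (rho (e2 0)) s * mxpow (rho (e2 1)) t.

(* The point [x : y : 1] as the column vector (x, y, 1), on which Heis_0 acts
   by multiplication. *)
Definition A2 : set 'cV[R]_3 := [set p : 'cV[R]_3 | p 2%:R 0 = 1].

Definition acts_freely (rho : int * int -> 'M[R]_3) : Prop :=
  forall s t p, A2 p -> rho_hat rho s t *m p = p -> s = 0 /\ t = 0.

Definition F : set U := classU @` [set rho : HomZ2 | acts_freely (set_val rho)].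

Definition dot (u v : 'rV[R]_2) : R := \sum_i u 0 i * v 0 i.

Definition T2 : set ('rV[R]_2 * 'rV[R]_2)%type :=
  [set w : 'rV[R]_2 * 'rV[R]_2 | w.1 0 0 * w.2 0 1 - w.1 0 1 * w.2 0 0 = 0 /\
           dot w.1 w.1 + dot w.2 w.2 = 1].

Definition circS : set ('rV[R]_2 * 'rV[R]_2)%type :=
  T2 `&` [set w : 'rV[R]_2 * 'rV[R]_2 | w.2 0 0 = 0 /\ w.2 0 1 = 0].

Definition normal_coords : set R6 :=
  [set c : R6 | [/\ T2 c.1, dot c.2 c.1.1 = 0 & dot c.2 c.1.2 = 0]].

(* A class in [Ustar] has exactly one representative with coordinates in
   [normal_coords]; a class outside [Ustar] has none and gets the value 0. *)
Definition normal_form (p : U) : R6 :=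
  xget 0 (normal_coords `&`
          [set coords (set_val rho) | rho in [set rho : HomZ2 | classU rho = p]]).

Definition bundle_proj (p : U) : ('rV[R]_2 * 'rV[R]_2)%type := (normal_form p).1.

Definition Rtimes : set R := [set r | r != 0].

Definition circle : set (R * R)%type := [set w : R * R | w.1 ^+ 2 + w.2 ^+ 2 = 1].

End Heisenberg.

Arguments Ustar : clear implicits.
Arguments F : clear implicits.
Arguments T2 : clear implicits.
Arguments circS : clear implicits.
Arguments bundle_proj : clear implicits.
Arguments Rtimes : clear implicits.
Arguments circle : clear implicits.

(* Main.v *)
Require Import Defs.
From mathcomp Require Import all_boot all_order all_algebra generic_quotient.
From mathcomp Require Import ring lra.
From mathcomp Require Import all_classical all_reals topology normedtype realfun.
Import Order.TTheory GRing.Theory Num.Theory.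
Import numFieldNormedType.Exports.

(** The base is elementary.  A linear change of coordinates turns the equations of
    the torus into p^2 + s^2 = 1 and q^2 + r^2 = 1 ([T2_homeomorphic]).  Off the
    circle S the vector y is nonzero and x is a multiple of it, so the direction of
    y and the slope of x over y are global coordinates on a cylinder
    ([cylinder_homeomorphic]).

    For the bundle, everything rests on the number z ^ y = z_1 y_2 - z_2 y_1.  The
    extension of rho is (s, t) |-> exp (s log (rho e_1) + t log (rho e_2)), and
    writing down the fixed points of such a matrix shows that rho acts freely iff
    z ^ y is nonzero ([acts_freelyP]).  Conjugation adds to z a combination of x
    and y ([same_orbit_coords]); as x ^ y = 0, it does not change z ^ y, while
    scaling by t multiplies it by t^2.  With n the norm of (x, y), the map
      [chart] : rho |-> ((x, y) / n, (z ^ y) / n^2)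
    is therefore defined on classes.  It sends F to the product of the cylinder
    with the nonzero reals, and its first component is the bundle projection
    ([bundle_proj_classU]).  Its inverse sends ((x, y), l) to the class of the
    representation with coordinates (x, y, l (y_2, - y_1) / |y|^2) ([lift],
    [holonomy]); it is the inverse because a conjugation can remove the component
    of z along y ([lift_chart_orbit]).

    The inverse is continuous as a composite of explicit formulas with the quotient
    map.  The chart is continuous because it is so on representations and because
    freeness is an open condition there ([free_open]), which lets the quotient
    topology be restricted to F ([quotient_continuous_on]). *)

Local Open Scope classical_set_scope.

Set Implicit Arguments.
Unset Strict Implicit.
Unset Printing Implicit Defensive.

(** * Topological embeddings and lifts of homeomorphisms *)

Section Embeddings.
Local Open Scope ring_scope.

(** The last clause is the universal property of the initial topology, which is
    the form in which continuity into a subspace is used. *)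
Definition embedding (A X : topologicalType) (i : A -> X) : Prop :=
  [/\ injective i, continuous i &
      forall (Z : topologicalType) (h : Z -> A),
        continuous (i \o h) -> continuous h].

Lemma embedding_set_val (X : topologicalType) (A : set X) :
  embedding (set_val : A -> X).
Proof.
split; first by move=> a b; rewrite set_valE /= => /val_inj.
  exact: initial_continuous.
by move=> Z h; exact: continuous_comp_initial.
Qed.

Lemma embedding_id (X : topologicalType) : embedding (id : X -> X).
Proof. by split=> // x; exact: cvg_id. Qed.

Lemma embedding_pair (A B X Y : topologicalType) (i : A -> X) (j : B -> Y) :
  embedding i -> embedding j ->
  embedding (fun p : A * B => (i p.1, j p.2)).
Proof.
move=> [iI iC iL] [jI jC jL]; split.
- by move=> [a b] [c d] /= [/iI-> /jI->].
- move=> p; apply: (@cvg_pair _ _ _ _ (nbhs (i p.1)) (nbhs (j p.2))).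
    by apply: (continuous_comp (f := fst)); [exact: cvg_fst|exact: iC].
  by apply: (continuous_comp (f := snd)); [exact: cvg_snd|exact: jC].
- move=> Z h hC z.
  have h1 : continuous (fst \o h).
    apply: iL => w; apply: (continuous_comp (g := fst) (hC w)); exact: cvg_fst.
  have h2 : continuous (snd \o h).
    apply: jL => w; apply: (continuous_comp (g := snd) (hC w)); exact: cvg_snd.
  rewrite (_ : h = fun z => ((fst \o h) z, (snd \o h) z)).
    by apply: (@cvg_pair _ _ _ _ (nbhs (h z).1) (nbhs (h z).2)); [exact: h1|exact: h2].
  by apply/funext => w /=; case: (h w).
Qed.

(** The subspaces [A] and [B] are handled through maps into their ambient spaces:
    when the values of [f] and [g] lift and match there, the initial topologies
    make the lifts continuous and injectivity makes them mutually inverse.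
    Keeping the formula [f] in the conclusion is what identifies the first
    component of a bundle trivialization. *)
Lemma homeomorphism_lift (A B X Y : topologicalType) (i : A -> X) (j : B -> Y)
    (f : A -> Y) (g : B -> X) :
  embedding i -> embedding j -> continuous f -> continuous g ->
  (forall a, exists b, j b = f a /\ g b = i a) ->
  (forall b, exists a, i a = g b /\ f a = j b) ->
  exists phi : A -> B, homeomorphism phi /\ forall a, j (phi a) = f a.
Proof.
move=> [iI _ iL] [jI _ jL] fC gC /choice[phi phiP] /choice[psi psiP].
exists phi; split; last by move=> a; case: (phiP a).
split.
  by apply: jL; rewrite (_ : j \o phi = f)//; apply/funext=> a; case: (phiP a).
exists psi; split.
- by apply: iL; rewrite (_ : i \o psi = g)//; apply/funext=> b; case: (psiP b).
- by move=> a; apply: iI; case: (psiP (phi a)) => ->; case: (phiP a).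
- by move=> b; apply: jI; case: (phiP (psi b)) => ->; case: (psiP b).
Qed.

Lemma set_val_ex (T : Type) (A : set T) x : A x -> exists a : A, set_val a = x.
Proof. by move=> /mem_set Ax; exists (exist _ x Ax). Qed.

Lemma set_val_in (T : Type) (A : set T) (a : A) : A (set_val a).
Proof. by rewrite set_valE /=; exact/set_mem/valP. Qed.

(** The case where both maps are given by formulas on the ambient spaces.  The
    target [B] is left abstract so that products of subspaces are covered. *)
Lemma homeomorphic_sub (X Y B : topologicalType) (A : set X) (j : B -> Y)
    (f : X -> Y) (g : Y -> X) :
  embedding j ->
  (forall x, A x -> continuous_at x f) -> (forall b, continuous_at (j b) g) ->
  (forall x, A x -> exists b, j b = f x) -> (forall b, A (g (j b))) ->
  (forall x, A x -> g (f x) = x) -> (forall b, f (g (j b)) = j b) ->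
  homeomorphic A B.
Proof.
move=> jE fC gC fB gA gf fg; have iE := @embedding_set_val X A.
have [|||| phi [phiH _]] :=
    homeomorphism_lift (f := f \o set_val) (g := g \o j) iE jE.
- move=> a; apply: continuous_comp; first exact: initial_continuous.
  by apply: fC; exact: set_val_in.
- move=> b; apply: continuous_comp; last exact: gC.
  by case: jE => _ + _; exact.
- move=> a; have [b jb] := fB _ (set_val_in a); exists b; split=> //=.
  by rewrite jb gf//; exact: set_val_in.
- move=> b; have [a ea] := set_val_ex (gA b); exists a; split=> //=.
  by rewrite ea fg.
by exists phi.
Qed.

Lemma continuous_mx (K : topologicalType) (Z : topologicalType) m n
    (f : Z -> 'M[K]_(m, n)) (z : Z) :
  (forall i j, continuous_at z (fun w => f w i j)) -> continuous_at z f.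
Proof.
move=> fC A [P zP PA]; rewrite /= nbhs_simpl.
have : \forall w \near z, forall i j, P i j (f w i j).
  apply: filter_forall => i; apply: filter_forall => j.
  by apply: fC; exact: zP.
by apply: filterS => w Pw; exact: PA.
Qed.

Lemma continuous_ptws (I : choiceType) (K : uniformType) (Z : topologicalType)
    (f : Z -> {ptws I -> K}) :
  (forall a, continuous (fun z => f z a)) -> continuous f.
Proof.
move=> fC z; apply/cvg_sup => a U [_ [[W oW <-] Wz] WU].
apply: filterS WU _; apply: (fC a z); exact: open_nbhs_nbhs.
Qed.

Lemma continuous_eval (I : eqType) (K : topologicalType) (a : I) :
  continuous (fun f : {ptws I -> K} => f a).
Proof. exact: proj_continuous. Qed.

(** The topology of a subset of a quotient is in general not the quotient topology
    of its preimage.  They agree when the preimage is open, so that continuity can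
    then be checked before passing to the quotient. *)
Lemma quotient_continuous_on (T : topologicalType) (Q : quotType T)
    (Z : topologicalType) (g : quotient_topology Q -> Z) (O : set (quotient_topology Q)) :
  (forall x : T, O (\pi_(quotient_topology Q)%qT x) ->
     (\forall y \near x, O (\pi_(quotient_topology Q)%qT y)) /\
     {for x, continuous (g \o \pi_(quotient_topology Q)%qT)}) ->
  continuous (g \o set_val : O -> Z).
Proof.
move=> OC.
have gO (W : set Z) : open W -> open (O `&` g @^-1` W).
  move=> oW; rewrite /open /= /quotient_open openE => x [Ox Wx].
  have [nO gx] := OC x Ox.
  have := gx W; rewrite nbhs_simpl => /(_ (open_nbhs_nbhs (conj oW Wx))).
  by apply: filterS2 nO => y.
apply/continuousP => W oW; exists (O `&` g @^-1` W); first exact: gO.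
apply/seteqP; split=> [p [_ ?]//|p Wp]; split=> //=.
by rewrite set_valE /=; exact/set_mem/valP.
Qed.
End Embeddings.

(** * Pointwise continuity *)

Section Pointwise.
Local Open Scope ring_scope.
Variables (Z : topologicalType) (z : Z).

Lemma continuous_fst_for (X Y : topologicalType) (f : Z -> X * Y) :
  continuous_at z f -> continuous_at z (fun w => (f w).1).
Proof. by move=> fC; apply: (continuous_comp (g := fst) fC); exact: cvg_fst. Qed.

Lemma continuous_snd_for (X Y : topologicalType) (f : Z -> X * Y) :
  continuous_at z f -> continuous_at z (fun w => (f w).2).
Proof. by move=> fC; apply: (continuous_comp (g := snd) fC); exact: cvg_snd. Qed.

Lemma continuous_pair_for (X Y : topologicalType) (f : Z -> X) (g : Z -> Y) :
  continuous_at z f -> continuous_at z g ->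
  continuous_at z (fun w => (f w, g w)).
Proof.
move=> fC gC; apply: (@cvg_pair _ _ _ _ (nbhs (f z)) (nbhs (g z))).
  exact: fC.
exact: gC.
Qed.

Variable R : realType.

Lemma continuous_entry_for m n (f : Z -> 'M[R]_(m, n)) i j :
  continuous_at z f -> continuous_at z (fun w => f w i j).
Proof.
move=> fC; apply: (continuous_comp (g := fun M : 'M[R]_(m, n) => M i j) fC).
exact: coord_continuous.
Qed.

Lemma continuous_add_for (f g : Z -> R) :
  continuous_at z f -> continuous_at z g ->
  continuous_at z (fun w => f w + g w).
Proof. by move=> fC gC; exact: continuousD. Qed.

Lemma continuous_opp_for (f : Z -> R) :
  continuous_at z f -> continuous_at z (fun w => - f w).
Proof. by move=> fC; exact: continuousN. Qed.

Lemma continuous_mul_for (f g : Z -> R) :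
  continuous_at z f -> continuous_at z g ->
  continuous_at z (fun w => f w * g w).
Proof. by move=> fC gC; exact: continuousM. Qed.

Lemma continuous_inv_for (f : Z -> R) : f z != 0 ->
  continuous_at z f -> continuous_at z (fun w => (f w)^-1).
Proof. by move=> f0 fC; exact: continuousV. Qed.

Lemma continuous_sqrt_for (f : Z -> R) :
  continuous_at z f -> continuous_at z (fun w => Num.sqrt (f w)).
Proof.
by move=> fC; apply: (continuous_comp (g := Num.sqrt) fC); exact: sqrt_continuous.
Qed.

Lemma continuous_cst_for (T : topologicalType) (c : T) :
  continuous_at z (fun _ : Z => c).
Proof. exact: cvg_cst. Qed.

Lemma continuous_id_for : continuous_at z (fun w : Z => w).
Proof. exact: cvg_id. Qed.

End Pointwise.

Section Vectors.
Local Open Scope ring_scope.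
Variable R : realType.
Implicit Types (u v : 'rV[R]_2) (a b : R).

Definition row2 a b : 'rV[R]_2 := \row_j (if j == 0 then a else b).

Lemma row2_0 a b : row2 a b 0 0 = a. Proof. by rewrite mxE. Qed.
Lemma row2_1 a b : row2 a b 0 1 = b. Proof. by rewrite mxE. Qed.
Definition row2E := (row2_0, row2_1).

Lemma row2_eq u v : u 0 0 = v 0 0 -> u 0 1 = v 0 1 -> u = v.
Proof.
move=> e0 e1; apply/rowP => -[[|[|//]] h].
  by rewrite (_ : Ordinal h = 0)//; exact: val_inj.
by rewrite (_ : Ordinal h = 1)//; exact: val_inj.
Qed.

Lemma row2_eta u : u = row2 (u 0 0) (u 0 1).
Proof. by apply: row2_eq; rewrite row2E. Qed.

Definition wedge u v : R := u 0 0 * v 0 1 - u 0 1 * v 0 0.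

Lemma dotE u v : dot u v = u 0 0 * v 0 0 + u 0 1 * v 0 1.
Proof.
rewrite /dot !big_ord_recl big_ord0 addr0.
by congr (_ + u _ _ * v _ _); exact: val_inj.
Qed.

Lemma continuous_row2 (Z : topologicalType) (z : Z) (f g : Z -> R) :
  continuous_at z f -> continuous_at z g ->
  continuous_at z (fun w => row2 (f w) (g w)).
Proof.
move=> fC gC; apply: continuous_mx => i j.
have [j0|j0] := eqVneq j 0.
  rewrite (_ : (fun w => _) = f)//; by apply/funext => w; rewrite mxE j0.
rewrite (_ : (fun w => _) = g)//; by apply/funext => w; rewrite mxE (negPf j0).
Qed.

End Vectors.

(** Syntax-directed, one operation at a time: letting unification look for a
    matching lemma would unfold the vectors and matrices involved. *)
Ltac continuity := repeat lazymatch goal with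
  | |- continuous_at _ (fun w => w) => exact: continuous_id_for
  | |- continuous_at _ (fun _ => ?c) => exact: continuous_cst_for
  | |- continuous_at _ (fun w => (@?f w, @?g w)) =>
      apply: (@continuous_pair_for _ _ _ _ f g)
  | |- continuous_at _ (fun w => @?f w + @?g w)%R =>
      apply: (@continuous_add_for _ _ _ f g)
  | |- continuous_at _ (fun w => - @?f w)%R => apply: (@continuous_opp_for _ _ _ f)
  | |- continuous_at _ (fun w => @?f w * @?g w)%R =>
      apply: (@continuous_mul_for _ _ _ f g)
  | |- continuous_at _ (fun w => (@?f w)^-1)%R => apply: (@continuous_inv_for _ _ _ f)
  | |- continuous_at _ (fun w => Num.sqrt (@?f w)) =>
      apply: (@continuous_sqrt_for _ _ _ f)
  | |- continuous_at _ (fun w => row2 (@?f w) (@?g w)) =>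
      apply: (@continuous_row2 _ _ _ f g)
  | |- continuous_at _ (fun w => fst (@?f w)) => apply: (@continuous_fst_for _ _ _ _ f)
  | |- continuous_at _ (fun w => snd (@?f w)) => apply: (@continuous_snd_for _ _ _ _ f)
  | |- continuous_at _ (fun w => fun_of_matrix (@?f w) _ _) =>
      apply: (@continuous_entry_for _ _ _ _ _ f)
  end.

Section VectorContinuity.
Local Open Scope ring_scope.
Variables (R : realType) (Z : topologicalType) (z : Z).

Lemma continuous_scale_for (f : Z -> R)
    (g : Z -> 'rV[R]_2) : continuous_at z f -> continuous_at z g ->
  continuous_at z (fun s => f s *: g s).
Proof.
move=> fC gC; apply: continuous_mx => i j.
under eq_fun do rewrite mxE.
by apply: continuous_mul_for => //; exact: continuous_entry_for.
Qed.

Lemma continuous_wedge_for (f g : Z -> 'rV[R]_2) :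
  continuous_at z f -> continuous_at z g ->
  continuous_at z (fun s => wedge (f s) (g s)).
Proof. by move=> fC gC; rewrite /wedge; continuity. Qed.

Lemma continuous_dot_for (f g : Z -> 'rV[R]_2) :
  continuous_at z f -> continuous_at z g ->
  continuous_at z (fun s => dot (f s) (g s)).
Proof.
move=> fC gC; rewrite (funext (fun s => dotE (f s) (g s))).
by continuity.
Qed.

End VectorContinuity.

(** * The torus, the circle and the cylinder *)

Section Quadric.
Local Open Scope ring_scope.
Variable R : realType.

(** In the coordinates p = x_1 + y_2, s = x_2 - y_1, q = x_1 - y_2, r = x_2 + y_1
    the form 4 (x_1 y_2 - x_2 y_1) is (p^2 + s^2) - (q^2 + r^2), while
    2 (|x|^2 + |y|^2) is the sum of the four squares.  Both equations of the torus
    together say p^2 + s^2 = q^2 + r^2 = 1; this is the inverse of that change of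
    coordinates. *)
Definition torus_param (w : R * R * (R * R)) : 'rV[R]_2 * 'rV[R]_2 :=
  (row2 ((w.1.1 + w.2.1) / 2) ((w.2.2 + w.1.2) / 2),
   row2 ((w.2.2 - w.1.2) / 2) ((w.1.1 - w.2.1) / 2)).

Lemma T2_homeomorphic : homeomorphic (T2 R) (circle R * circle R)%type.
Proof.
have jE := embedding_pair (@embedding_set_val _ (circle R))
  (@embedding_set_val _ (circle R)).
pose torus_coord (w : 'rV[R]_2 * 'rV[R]_2) : R * R * (R * R) :=
  ((w.1 0 0 + w.2 0 1, w.1 0 1 - w.2 0 0), (w.1 0 0 - w.2 0 1, w.1 0 1 + w.2 0 0)).
have coordC : continuous torus_coord by move=> w; rewrite /torus_coord; continuity.
have paramC : continuous torus_param.
  by move=> w; rewrite /torus_param; continuity.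
have coordK w : torus_param (torus_coord w) = w.
  by case: w => x y; congr (_, _); apply: row2_eq; rewrite !row2E /=; field.
have paramK w : torus_coord (torus_param w) = w.
  case: w => -[a b] [c d]; rewrite /torus_coord /torus_param/= !row2E.
  by congr (_, _, (_, _)); field.
have T2P w : T2 R w <-> circle R (torus_coord w).1 /\ circle R (torus_coord w).2.
  rewrite /T2 /circle /= !dotE; split=> [[h1 h2]|[h1 h2]]; split; lra.
apply: (homeomorphic_sub (f := torus_coord) (g := torus_param) jE)
  => [x _|b|x /T2P[c1 c2]|b|x _|b].
- exact: coordC.
- exact: paramC.
- have [b1 e1] := set_val_ex c1; have [b2 e2] := set_val_ex c2.
  by exists (b1, b2); rewrite /= e1 e2.
- by apply/T2P; rewrite paramK; split; exact: set_val_in.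
- exact: coordK.
- exact: paramK.
Qed.
End Quadric.

Section Cylinder.
Local Open Scope ring_scope.
Variable R : realType.

Lemma circS_homeomorphic : homeomorphic (circS R) (circle R).
Proof.
pose f (w : 'rV[R]_2 * 'rV[R]_2) : R * R := (w.1 0 0, w.1 0 1).
pose g (a : R * R) : 'rV[R]_2 * 'rV[R]_2 := (row2 a.1 a.2, row2 0 0).
apply: (homeomorphic_sub (f := f) (g := g) (@embedding_set_val _ (circle R))).
- by move=> w _; rewrite /f; continuity.
- by move=> b; rewrite /g; continuity.
- move=> w [[_ +] [y0 y1]]; rewrite !dotE y0 y1 => n1; apply: set_val_ex.
  rewrite /circle /=; lra.
- move=> b; have := set_val_in b; rewrite /circle /= => n1.
  by split; [split|]; rewrite /= ?dotE !row2E //; lra.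
- move=> [x y] [_ [/= y0 y1]]; congr (_, _); first by rewrite -row2_eta.
  by rewrite [RHS]row2_eta y0 y1.
- by move=> b; rewrite /f /= !row2E -surjective_pairing.
Qed.

Lemma sqr_sum_gt0 (a b : R) : (a != 0) || (b != 0) -> 0 < a ^+ 2 + b ^+ 2.
Proof.
have [->|a0 _] := eqVneq a 0; last first.
  by rewrite ltr_wpDr ?sqr_ge0// exprn_even_gt0.
by move=> /= b0; rewrite expr0n add0r exprn_even_gt0.
Qed.

Lemma dot_gt0 (y : 'rV[R]_2) : (y 0 0 != 0) || (y 0 1 != 0) -> 0 < dot y y.
Proof. by move=> /sqr_sum_gt0; rewrite dotE. Qed.

Lemma circSCP (w : 'rV[R]_2 * 'rV[R]_2) :
  (T2 R `\` circS R) w <-> T2 R w /\ 0 < dot w.2 w.2.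
Proof.
split=> [[Tw nS]|[Tw y0]]; split=> //.
  apply: dot_gt0; rewrite -negb_and; apply/negP => /andP[/eqP y0 /eqP y1].
  by apply: nS.
by move=> [_ [y00 y01]]; move: y0; rewrite dotE y00 y01; lra.
Qed.

Lemma wedge0_slope (x y : 'rV[R]_2) : wedge x y = 0 -> 0 < dot y y ->
  x = (dot x y / dot y y) *: y.
Proof.
move=> xy /lt0r_neq0 y0; apply: row2_eq; rewrite mxE; apply: (mulIf y0);
  rewrite mulrAC divfK//.
  transitivity (dot x y * y 0 0 + wedge x y * y 0 1).
    by rewrite /wedge !dotE; ring.
  by rewrite xy mul0r addr0.
transitivity (dot x y * y 0 1 - wedge x y * y 0 0).
  by rewrite /wedge !dotE; ring.
by rewrite xy mul0r subr0.
Qed.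

(** Away from [circS] the vector y does not vanish, so x = tau y with
    tau = (x . y) / |y|^2, and (x, y) is determined by the direction y / |y| and by
    the slope tau.  The normalization gives |y|^2 (1 + tau^2) = 1, hence
    1 / |y| = sqrt (1 + tau^2). *)
Lemma cylinder_homeomorphic :
  homeomorphic (T2 R `\` circS R) (circle R * R)%type.
Proof.
have jE := embedding_pair (@embedding_set_val _ (circle R)) (@embedding_id R).
pose tau (w : 'rV[R]_2 * 'rV[R]_2) :=
  (w.1 0 0 * w.2 0 0 + w.1 0 1 * w.2 0 1) / (w.2 0 0 * w.2 0 0 + w.2 0 1 * w.2 0 1).
have tauE w : tau w = dot w.1 w.2 / dot w.2 w.2 by rewrite /tau !dotE.
pose f (w : 'rV[R]_2 * 'rV[R]_2) : R * R * R :=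
  ((w.2 0 0 * Num.sqrt (1 + tau w * tau w), w.2 0 1 * Num.sqrt (1 + tau w * tau w)),
   tau w).
pose g (a : R * R * R) : 'rV[R]_2 * 'rV[R]_2 :=
  let c := (Num.sqrt (1 + a.2 * a.2))^-1 in
  (row2 (a.2 * (a.1.1 * c)) (a.2 * (a.1.2 * c)), row2 (a.1.1 * c) (a.1.2 * c)).
have s0 (t : R) : Num.sqrt (1 + t * t) != 0.
  by rewrite gt_eqF// sqrtr_gt0 ltr_pwDl// -expr2 sqr_ge0.
have s2 (t : R) : Num.sqrt (1 + t * t) * Num.sqrt (1 + t * t) = 1 + t * t.
  by rewrite -expr2 sqr_sqrtr// addr_ge0// -expr2 sqr_ge0.
have xtau w : T2 R w -> 0 < dot w.2 w.2 -> w.1 = tau w *: w.2.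
  by move=> [xy _] y0; rewrite tauE; exact: wedge0_slope.
have gden a : circle R a.1 -> dot (g a).2 (g a).2 * (1 + a.2 * a.2) = 1.
  case: a => -[u v] t; rewrite /circle dotE /g /= !row2E => uv1.
  transitivity (u ^+ 2 + v ^+ 2) => //.
  by move: (s2 t) (s0 t); move: (Num.sqrt _) => c <- c0; field.
have gpos a : circle R a.1 -> 0 < dot (g a).2 (g a).2.
  move=> /gden e; rewrite -(pmulr_lgt0 (x := 1 + a.2 * a.2)) ?e ?ltr01//.
  by rewrite ltr_pwDl// -expr2 sqr_ge0.
have gtau a : circle R a.1 -> tau (g a) = a.2.
  move=> ca; have /lt0r_neq0 y0 := gpos a ca; rewrite tauE; apply: (mulIf y0).
  by rewrite divfK//; case: a {ca y0} => -[u v] t; rewrite !dotE /g /= !row2E; ring.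
apply: (homeomorphic_sub (f := f) (g := g) jE).
- move=> w /circSCP[_]; rewrite dotE => /lt0r_neq0 y0.
  by rewrite /f /tau; continuity.
- by move=> b; rewrite /g /=; continuity; exact: s0.
- move=> w /circSCP[Tw y0].
  have c1 : circle R (f w).1.
    have := xtau w Tw y0; rewrite /circle /f /=; move: (tau w) (s2 (tau w)).
    move=> t st xt; rewrite !exprMn -mulrDl [X in _ * X]expr2 st.
    by case: Tw => _ n1; rewrite -[RHS]n1 xt !dotE !mxE; ring.
  have [b bE] := set_val_ex c1; by exists (b, tau w); rewrite /= bE.
- move=> [b t]; apply/circSCP; have cb := set_val_in b; split; last exact: gpos.
  split; first by rewrite /g /= !row2E; ring.
  rewrite -[RHS](gden (set_val b, t) cb) !dotE /g /= !row2E; ring.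
- move=> [x y] /circSCP[Tw y0]; have := xtau _ Tw y0; rewrite /f /g /=.
  move: (tau (x, y)) (s0 (tau (x, y))) => t t0 xE.
  congr (_, _); rewrite !mulfK//; last by rewrite -row2_eta.
  by rewrite xE; apply: row2_eq; rewrite row2E mxE.
- move=> [b t]; have cb := set_val_in b; have := gtau (set_val b, t) cb.
  rewrite /f => -> /=; congr (_, _); rewrite !row2E !mulfVK//.
  by rewrite -surjective_pairing.
Qed.
End Cylinder.

(** * The Heisenberg group in coordinates *)

Ltac by_entries :=
  apply/matrixP => -[[|[|[|//]]] ?] [[|[|[|//]]] ?];
  rewrite !(mxE, big_ord_recl, big_ord0) /=.

Section Heisenberg.
Local Open Scope ring_scope.
Variable R : realType.
Implicit Types (A h : 'M[R]_3) (rho : @HomZ2 R).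

Definition heis (a b c : R) : 'M[R]_3 :=
  \matrix_(i, j) nth 0 (nth [::] [:: [:: 1; a; c]; [:: 0; 1; b]; [:: 0; 0; 1]] i) j.

Definition nil3 (x y z : R) : 'M[R]_3 :=
  \matrix_(i, j) nth 0 (nth [::] [:: [:: 0; x; z]; [:: 0; 0; y]; [:: 0; 0; 0]] i) j.

Lemma heisM a b c a' b' c' :
  heis a b c * heis a' b' c' = heis (a + a') (b + b') (c + c' + a * b').
Proof. by by_entries; ring. Qed.

Lemma nil3M x y z x' y' z' : nil3 x y z * nil3 x' y' z' = nil3 0 0 (x * y').
Proof. by by_entries; ring. Qed.

Lemma nil3D x y z x' y' z' :
  nil3 x y z + nil3 x' y' z' = nil3 (x + x') (y + y') (z + z').
Proof. by by_entries; ring. Qed.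

Lemma nil3Z t x y z : t *: nil3 x y z = nil3 (t * x) (t * y) (t * z).
Proof. by by_entries; ring. Qed.

Lemma heis1D x y z : 1 + nil3 x y z = heis x y z.
Proof. by by_entries; ring. Qed.

Lemma heis01 a b c : heis a b c 0 1 = a. Proof. by rewrite mxE. Qed.
Lemma heis12 a b c : heis a b c 1 2%:R = b. Proof. by rewrite mxE. Qed.
Lemma heis02 a b c : heis a b c 0 2%:R = c. Proof. by rewrite mxE. Qed.
Lemma nil301 a b c : nil3 a b c 0 1 = a. Proof. by rewrite mxE. Qed.
Lemma nil312 a b c : nil3 a b c 1 2%:R = b. Proof. by rewrite mxE. Qed.
Lemma nil302 a b c : nil3 a b c 0 2%:R = c. Proof. by rewrite mxE. Qed.

Lemma upper_nil3 x y z : upper 1 (nil3 x y z).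
Proof. by move=> [[|[|[|//]]] ?] [[|[|[|//]]] ?] //=; rewrite mxE. Qed.

Lemma Heis0_heis a b c : Heis0 (heis a b c).
Proof. by apply/Heis0P; rewrite -heis1D addrC addKr; exact: upper_nil3. Qed.

Lemma upper1E A : upper 1 A -> A = nil3 (A 0 1) (A 1 2%:R) (A 0 2%:R).
Proof.
move=> A1; apply: upper1_eq => //; first exact: upper_nil3.
- by rewrite nil301.
- by rewrite nil312.
- by rewrite nil302.
Qed.

Lemma Heis0E A : Heis0 A -> A = heis (A 0 1) (A 1 2%:R) (A 0 2%:R).
Proof.
move=> /Heis0P/upper1E e; rewrite -heis1D -[LHS](subrK 1) addrC e; congr (1 + nil3 _ _ _).
- by rewrite !mxE subr0.
- by rewrite !mxE subr0.
- by rewrite !mxE subr0.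
Qed.

Lemma mxlog_heis a b c : mxlog (heis a b c) = nil3 a b (c - a * b / 2).
Proof.
rewrite mxlogE -heis1D [1 + _]addrC addrK nil3M nil3Z -scaleN1r nil3Z nil3D.
by congr nil3; ring.
Qed.

Lemma mxexp_nil3 x y z : mxexp (nil3 x y z) = heis x y (z + x * y / 2).
Proof.
rewrite /mxexp !big_nat_recl// big_nil addr0 expr0 expr1 expr2 nil3M !nil3Z nil3D.
by rewrite fact0 invr1 scale1r heis1D; congr heis; rewrite /= ?factS ?fact0 ?muln1; field.
Qed.

Lemma mxlogK A : Heis0 A -> mxexp (mxlog A) = A.
Proof. by move=> /Heis0E->; rewrite mxlog_heis mxexp_nil3 subrK. Qed.

Lemma mxexpK x y z : mxlog (mxexp (nil3 x y z)) = nil3 x y z.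
Proof. by rewrite mxexp_nil3 mxlog_heis addrK. Qed.

Definition cx rho : 'rV[R]_2 := (coords (set_val rho)).1.1.
Definition cy rho : 'rV[R]_2 := (coords (set_val rho)).1.2.
Definition cz rho : 'rV[R]_2 := (coords (set_val rho)).2.

Lemma log_coords rho i :
  mxlog (set_val rho (e2 i)) = nil3 (cx rho 0 i) (cy rho 0 i) (cz rho 0 i).
Proof. by rewrite [LHS]upper1E ?/cx ?/cy ?/cz ?mxE//; exact/mxlog_upper/Hom_Heis0. Qed.

Lemma rep_coords rho i : set_val rho (e2 i) =
  heis (cx rho 0 i) (cy rho 0 i) (cz rho 0 i + cx rho 0 i * cy rho 0 i / 2).
Proof.
by rewrite -mxexp_nil3 -log_coords mxlogK//; exact: Hom_Heis0.
Qed.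

(** x ^ y is the upper right entry of the commutator of rho(e_1) and rho(e_2). *)
Lemma coords_commute rho : wedge (cx rho) (cy rho) = 0.
Proof.
have ab (u v : int * int) : set_val rho u * set_val rho v = set_val rho v * set_val rho u.
  by have [_ _ m] := set_val_in rho; rewrite -!m addrC.
have := ab (e2 0) (e2 1); rewrite !rep_coords !heisM.
by move=> /(congr1 (fun A : 'M_3 => A 0 2%:R)); rewrite !heis02 /wedge; lra.
Qed.

Lemma heis_fix a b c (p : 'cV[R]_3) : A2 p ->
  heis a b c *m p = p <-> b = 0 /\ a * p 1 0 + c = 0.
Proof.
rewrite /A2 /= => p2.
have e0 : (heis a b c *m p) 0 0 = p 0 0 + (a * p 1 0 + c).
  rewrite mxE !big_ord_recl big_ord0 !mxE /= mul1r addr0.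
  rewrite (_ : lift ord0 ord0 = 1); last exact: val_inj.
  by rewrite (_ : lift ord0 (lift ord0 ord0) = 2%:R) ?p2 ?mulr1//; exact: val_inj.
have e1 : (heis a b c *m p) 1 0 = p 1 0 + b.
  rewrite mxE !big_ord_recl big_ord0 !mxE /= mul0r mul1r addr0 add0r.
  rewrite (_ : lift ord0 ord0 = 1); last exact: val_inj.
  by rewrite (_ : lift ord0 (lift ord0 ord0) = 2%:R) ?p2 ?mulr1//; exact: val_inj.
have e2 : (heis a b c *m p) 2%:R 0 = p 2%:R 0.
  rewrite mxE !big_ord_recl big_ord0 !mxE /= !mul0r mul1r addr0 !add0r.
  by rewrite (_ : lift ord0 (lift ord0 ord0) = 2%:R)//; exact: val_inj.
split=> [e|[b0 c0]].
  split; first by have := e1; rewrite e; lra.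
  by have := e0; rewrite e; lra.
apply/matrixP => i j; rewrite (ord1 j); case: i => -[|[|[|//]]] h.
- by rewrite (_ : Ordinal h = 0) ?e0 ?c0 ?addr0//; exact: val_inj.
- by rewrite (_ : Ordinal h = 1) ?e1 ?b0 ?addr0//; exact: val_inj.
- by rewrite (_ : Ordinal h = 2%:R) ?e2//; exact: val_inj.
Qed.

(** The linear form on R^2 with coefficients [c].  Applied to the three vectors of
    coordinates it gives the logarithm of the extended representation. *)
Definition pencil (c : 'rV[R]_2) (s t : R) : R := s * c 0 0 + t * c 0 1.

(** As the two logarithms commute, the extended representation is the exponential
    of the linear map (s, t) |-> s log (rho e_1) + t log (rho e_2). *)
Lemma rho_hatE rho s t : rho_hat (set_val rho) s t =
  heis (pencil (cx rho) s t) (pencil (cy rho) s t)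
    (pencil (cz rho) s t + pencil (cx rho) s t * pencil (cy rho) s t / 2).
Proof.
rewrite /rho_hat /mxpow !log_coords !nil3Z !mxexp_nil3 heisM /pencil.
have /(congr1 ( *%R (s * t))) := coords_commute rho; rewrite mulr0 /wedge => xy.
by congr heis; lra.
Qed.

(** Write X, Y, Z for the coordinates of the logarithm at (s, t).  A fixed point with
    second coordinate b exists iff Y = 0 and X b + Z = 0.

    If z and y are independent, Y = 0 forces X = 0 because x is parallel to y, then
    Z = 0, and Y = Z = 0 gives s = t = 0.  If they are dependent, a nonzero (s, t)
    with a fixed point is found as follows: on the line Y = 0 if y is nonzero, where
    X and Z vanish too; at (s, t) = x if y = 0 and x is nonzero, since then
    X = |x|^2 allows solving for b; on a line where Z = 0 if x = y = 0. *)
Lemma acts_freelyP rho : acts_freely (set_val rho) <-> wedge (cz rho) (cy rho) != 0.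
Proof.
have xy := coords_commute rho.
pose fix_ s t (p : 'cV[R]_3) := rho_hat (set_val rho) s t *m p = p.
have fixP s t p : A2 p -> fix_ s t p <-> pencil (cy rho) s t = 0 /\
    pencil (cx rho) s t * p 1 0 + pencil (cz rho) s t = 0.
  move=> /heis_fix pA; rewrite /fix_ rho_hatE pA.
  by split=> -[-> e]; split=> //; move: e; rewrite mulr0 mul0r addr0.
rewrite /wedge; move: (cx rho) (cy rho) (cz rho) xy fixP => x y z xy fixP.
pose pt b : 'cV[R]_3 := \col_i (if i == 1 then b else 1).
have ptA b : A2 (pt b) by rewrite /A2 /= mxE.
have pt1 b : pt b 1 0 = b by rewrite mxE.
split=> [free|zy s t p pA].
  apply/eqP => zy.
  have nofix s t b : pencil y s t = 0 -> pencil x s t * b + pencil z s t = 0 ->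
      s = 0 /\ t = 0.
    by move=> ys xs; apply: (free s t (pt b)) => //; apply/fixP; rewrite ?pt1.
  have [y0|] := boolP ((y 0 0 == 0) && (y 0 1 == 0)); last first.
    move=> /negP; apply; have := nofix (y 0 1) (- y 0 0) 0.
    rewrite /pencil => /(_ ltac:(ring) ltac:(lra))[-> /eqP].
    by rewrite oppr_eq0 eqxx => ->.
  case/andP: y0 => /eqP y0 /eqP y1.
  have py s t : pencil y s t = 0 by rewrite /pencil y0 y1 !mulr0 addr0.
  have [x0|x0] := boolP ((x 0 0 == 0) && (x 0 1 == 0)); last first.
    have n0 : x 0 0 ^+ 2 + x 0 1 ^+ 2 != 0 by rewrite gt_eqF// sqr_sum_gt0// -negb_and.
    have [||xx0 xx1] := nofix (x 0 0) (x 0 1)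
      (- pencil z (x 0 0) (x 0 1) / (x 0 0 ^+ 2 + x 0 1 ^+ 2)).
    - exact: py.
    - by rewrite /pencil; field.
    by rewrite xx0 xx1 eqxx in x0.
  case/andP: x0 => /eqP x0 /eqP x1.
  have px s t : pencil x s t = 0 by rewrite /pencil x0 x1 !mulr0 addr0.
  have [z1 z0] : z 0 1 = 0 /\ - z 0 0 = 0.
    by apply: (nofix _ _ 0 (py _ _)); rewrite px /pencil; ring.
  have [|/eqP] := nofix 1 0 0 (py _ _); last by rewrite oner_eq0.
  by rewrite px /pencil z1; lra.
move=> /(fixP _ _ _ pA)[]; rewrite /pencil => ys xs.
(* The Pluecker relation X (z ^ y) = (z ^ x) Y + Z (x ^ y). *)
have xw : (s * x 0 0 + t * x 0 1) * (z 0 0 * y 0 1 - z 0 1 * y 0 0) = 0.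
  transitivity ((z 0 0 * x 0 1 - z 0 1 * x 0 0) * (s * y 0 0 + t * y 0 1) +
    (s * z 0 0 + t * z 0 1) * (x 0 0 * y 0 1 - x 0 1 * y 0 0)); first by ring.
  by rewrite ys -/(wedge x y) xy !mulr0 addr0.
have /eqP := xw; rewrite mulf_eq0 (negPf zy) orbF => /eqP x_0.
move: xs; rewrite x_0 mul0r add0r => zs.
split; apply: (mulIf zy); rewrite mul0r.
  transitivity (y 0 1 * (s * z 0 0 + t * z 0 1) - z 0 1 * (s * y 0 0 + t * y 0 1)); first by
    ring.
  by rewrite ys zs !mulr0 subr0.
transitivity (z 0 0 * (s * y 0 0 + t * y 0 1) - y 0 0 * (s * z 0 0 + t * z 0 1)); first by
  ring.
by rewrite ys zs !mulr0 subr0.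
Qed.

End Heisenberg.

(** * Representations and their coordinates *)

Section Representations.
Local Open Scope ring_scope.
Variable R : realType.
Implicit Types (rho : @HomZ2 R) (c : R6 R).

Lemma heis_conj a b e x y z : heis a b e * nil3 x y z * (heis a b e)^-1 =
  nil3 x y (z + a * y - b * x) :> 'M[R]_3.
Proof.
have [uh _] := Heis0_inv (Heis0_heis a b e).
apply: (canLR (mulrK uh)).
by by_entries; ring.
Qed.

(** Conjugation by an element with coordinates (a, b, c) shears z by a y - b x and
    fixes x and y, and the other factor of the action is a dilation. *)
Lemma same_orbit_coords rho1 rho2 : same_orbit rho1 rho2 <->
  exists a b t, [/\ 0 < t, cx rho2 = t *: cx rho1, cy rho2 = t *: cy rho1 &
    cz rho2 = t *: (cz rho1 + a *: cy rho1 - b *: cx rho1)].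
Proof.
split.
  move=> /same_orbitP[h [t [/Heis0E-> t0 e]]].
  exists (h 0 1), (h 1 2%:R), t; split=> //; apply/rowP => i;
    have := e i; rewrite !log_coords heis_conj nil3Z;
    move: (cx rho1) (cy rho1) (cz rho1) (cx rho2) (cy rho2) (cz rho2) => x y z x' y' z'.
  - by move=> /(congr1 (fun A : 'M_3 => A 0 1)); rewrite !nil301 => ->; rewrite mxE.
  - by move=> /(congr1 (fun A : 'M_3 => A 1 2%:R)); rewrite !nil312 => ->; rewrite mxE.
  - by move=> /(congr1 (fun A : 'M_3 => A 0 2%:R)); rewrite !nil302 => ->; rewrite !mxE.
move=> [a [b [t [t0 ex ey ez]]]]; apply/same_orbitP.
exists (heis a b 0), t; split=> //; first exact: Heis0_heis.
by move=> i; rewrite !log_coords heis_conj nil3Z ex ey ez !mxE.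
Qed.

(** The map (m, n) |-> exp (m L_1 + n L_2), where L_i has coordinates (x_i, y_i, z_i). *)
Definition holonomy c (a : int * int) : 'M[R]_3 :=
  let l (u : 'rV[R]_2) := pencil u a.1%:~R a.2%:~R in
  heis (l c.1.1) (l c.1.2) (l c.2 + l c.1.1 * l c.1.2 / 2).

Lemma holonomy_hom c : wedge c.1.1 c.1.2 = 0 -> HomZ2 (holonomy c).
Proof.
move=> xy; split.
- by move=> a; exact: Heis0_heis.
- rewrite /holonomy /pencil /= !(mul0r, addr0).
  by apply/matrixP => -[[|[|[|//]]] ?] [[|[|[|//]]] ?]; rewrite !mxE /=.
- move=> [m n] [m' n']; rewrite /holonomy heisM /pencil /= !intrD.
  (* The upper right entries of both sides differ by a multiple of x ^ y. *)
  have /(congr1 ( *%R (m'%:~R * n%:~R - m%:~R * n'%:~R))) := xy.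
  rewrite mulr0 /wedge => e; congr heis; lra.
Qed.

Lemma holonomy_coords c : coords (holonomy c) = c.
Proof.
have e i : mxlog (holonomy c (e2 i)) = nil3 (c.1.1 0 i) (c.1.2 0 i) (c.2 0 i).
  rewrite /holonomy -mxexp_nil3 mxexpK.
  by congr nil3; rewrite /pencil; case: i => -[|[|//]] h /=;
   rewrite ?mul1r ?mul0r ?addr0 ?add0r; congr (fun_of_matrix _ _ _); exact: val_inj.
case: c e => -[x y] z /= e.
by congr (_, _, _); apply/rowP => i; rewrite mxE e ?nil301 ?nil312 ?nil302.
Qed.

Lemma coords_cxE rho : cx rho = row2 (set_val rho (e2 0) 0 1) (set_val rho (e2 1) 0 1).
Proof. by rewrite !rep_coords; apply: row2_eq; rewrite row2E heis01. Qed.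

Lemma coords_cyE rho :
  cy rho = row2 (set_val rho (e2 0) 1 2%:R) (set_val rho (e2 1) 1 2%:R).
Proof. by rewrite !rep_coords; apply: row2_eq; rewrite row2E heis12. Qed.

Lemma coords_czE rho : cz rho = row2
  (set_val rho (e2 0) 0 2%:R - set_val rho (e2 0) 0 1 * set_val rho (e2 0) 1 2%:R / 2)
  (set_val rho (e2 1) 0 2%:R - set_val rho (e2 1) 0 1 * set_val rho (e2 1) 1 2%:R / 2).
Proof.
by rewrite !rep_coords; apply: row2_eq; rewrite row2E heis01 heis12 heis02 addrK.
Qed.

Lemma continuous_generator (a : int * int) rho :
  continuous_at rho (fun r : @HomZ2 R => set_val r a).
Proof.
apply: (continuous_comp (f := set_val)
  (g := fun f : {ptws (int * int)%type -> 'M[R]_3} => f a)).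
  exact: initial_continuous.
exact: continuous_eval.
Qed.

Lemma continuous_cx rho : continuous_at rho (@cx R).
Proof.
rewrite (funext coords_cxE).
by continuity; exact: continuous_generator.
Qed.

Lemma continuous_cy rho : continuous_at rho (@cy R).
Proof.
rewrite (funext coords_cyE).
by continuity; exact: continuous_generator.
Qed.

Lemma continuous_cz rho : continuous_at rho (@cz R).
Proof.
rewrite (funext coords_czE).
by continuity; exact: continuous_generator.
Qed.

End Representations.

(** * The trivialization *)

Section Trivialization.
Local Open Scope ring_scope.
Variable R : realType.
Implicit Types (rho : @HomZ2 R) (c : R6 R) (w : 'rV[R]_2 * 'rV[R]_2).

Definition xy_norm w : R := Num.sqrt (dot w.1 w.1 + dot w.2 w.2).

(** The pair (x, y) scaled to the unit sphere, and the fibre coordinate: z ^ y is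
    homogeneous of degree 2, so it is divided by the square of the norm of (x, y). *)
Definition chart c : 'rV[R]_2 * 'rV[R]_2 * R :=
  let r := (xy_norm c.1)^-1 in
  ((r *: c.1.1, r *: c.1.2), wedge c.2 c.1.2 * (r * r)).

(** Inverse to [chart] on normal coordinates: z is the multiple of (y_2, - y_1)
    whose wedge product with y is the given fibre coordinate.  It is orthogonal to
    y, hence to x, which is a multiple of y. *)
Definition lift (v : 'rV[R]_2 * 'rV[R]_2 * R) : R6 R :=
  let y := v.1.2 in
  (v.1, row2 (v.2 / dot y y * y 0 1) (- (v.2 / dot y y * y 0 0))).

Lemma dotZ (t : R) (u : 'rV[R]_2) : dot (t *: u) (t *: u) = t ^+ 2 * dot u u.
Proof. by rewrite !dotE !mxE; ring. Qed.

Lemma dot_ge0 (u : 'rV[R]_2) : 0 <= dot u u.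
Proof. by rewrite dotE addr_ge0// -expr2 sqr_ge0. Qed.

Lemma wedge_shift (a b t : R) (x y z : 'rV[R]_2) : wedge x y = 0 ->
  wedge (t *: (z + a *: y - b *: x)) (t *: y) = t ^+ 2 * wedge z y.
Proof.
move=> xy; transitivity (t ^+ 2 * wedge z y - b * t ^+ 2 * wedge x y).
  by rewrite /wedge !mxE; ring.
by rewrite xy mulr0 subr0.
Qed.

Lemma chart_orbit rho1 rho2 : same_orbit rho1 rho2 ->
  chart (coords (set_val rho2)) = chart (coords (set_val rho1)).
Proof.
move=> /same_orbit_coords[a [b [t [t0 ex ey ez]]]].
rewrite /chart -!/(cx _) -!/(cy _) -!/(cz _).
have -> : xy_norm (coords (set_val rho2)).1 = t * xy_norm (coords (set_val rho1)).1.
  rewrite /xy_norm -!/(cx _) -!/(cy _) ex ey !dotZ -mulrDr sqrtrM ?sqr_ge0//.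
  by rewrite sqrtr_sqr gtr0_norm.
move: (xy_norm _) => n; rewrite ex ey ez wedge_shift; last exact: coords_commute.
have rt u : (t * n)^-1 *: (t *: u) = n^-1 *: u :> 'rV[R]_2.
  by rewrite scalerA invfM mulrAC mulVf ?mul1r// gt_eqF.
rewrite !rt; congr (_, _); rewrite invfM.
transitivity (wedge (cz rho1) (cy rho1) * (n^-1 * n^-1) * ((t^-1 * t) * (t^-1 * t))).
  by ring.
by rewrite mulVf ?gt_eqF// !mulr1.
Qed.

Lemma free_dot rho : acts_freely (set_val rho) -> 0 < dot (cy rho) (cy rho).
Proof.
move=> /acts_freelyP zy; apply: dot_gt0; apply: contraNT zy.
by rewrite negb_or !negbK /wedge => /andP[/eqP-> /eqP->]; rewrite !mulr0 subrr.
Qed.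

Lemma xy_norm_gt0 w : 0 < dot w.2 w.2 -> 0 < xy_norm w.
Proof. by move=> y0; rewrite sqrtr_gt0 ltr_wpDl ?dot_ge0. Qed.

Lemma chart_slope c : wedge c.1.1 c.1.2 = 0 -> 0 < dot c.1.2 c.1.2 ->
  (T2 R `\` circS R) (chart c).1.
Proof.
case: c => -[x y] z /= xy y0; have n0 := xy_norm_gt0 (w := (x, y)) y0.
apply/circSCP; rewrite /chart /=.
split; last by rewrite dotZ mulr_gt0// exprn_gt0// invr_gt0.
split=> /=.
  transitivity ((xy_norm (x, y))^-1 ^+ 2 * wedge x y); last by rewrite xy mulr0.
  by rewrite /wedge !mxE; ring.
rewrite !dotZ -mulrDr exprVn sqr_sqrtr ?addr_ge0 ?dot_ge0//.
by rewrite mulVf// gt_eqF// ltr_wpDl ?dot_ge0.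
Qed.

Lemma chart_fibre c : 0 < dot c.1.2 c.1.2 -> wedge c.2 c.1.2 != 0 ->
  Rtimes R (chart c).2.
Proof.
move=> /xy_norm_gt0 n0 zy.
by apply: mulf_neq0 => //; apply: mulf_neq0; rewrite invr_neq0// gt_eqF.
Qed.

Lemma wedge_lift v : 0 < dot v.1.2 v.1.2 -> wedge (lift v).2 v.1.2 = v.2.
Proof.
case: v => -[x y] l /= /lt0r_neq0; rewrite /wedge /= !row2E dotE => y0.
by field.
Qed.

Lemma chart_normed c : T2 R c.1 -> chart c = (c.1, wedge c.2 c.1.2).
Proof.
move=> [_ n1]; rewrite /chart (_ : xy_norm c.1 = 1); last first.
  by rewrite /xy_norm n1 sqrtr1.
by rewrite invr1 !scale1r !mulr1; case: c {n1} => -[].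
Qed.

Lemma chart_lift v : (T2 R `\` circS R) v.1 -> chart (lift v) = v.
Proof.
by move=> /circSCP[Tv y0]; rewrite chart_normed// wedge_lift//; case: v {Tv y0}.
Qed.

Lemma lift_normal v : (T2 R `\` circS R) v.1 -> normal_coords (lift v).
Proof.
move=> /circSCP[Tv y0]; split=> //.
  case: v Tv {y0} => -[x y] l [/= xy _].
  rewrite dotE /= !row2E.
  transitivity (l / dot y y * (x 0 0 * y 0 1 - x 0 1 * y 0 0)); first by ring.
  by rewrite xy mulr0.
by rewrite dotE /= !row2E; ring.
Qed.

(** The component of z along (y_2, - y_1) is what remains of z after removing its
    projection to y, and a conjugation can remove that projection. *)
Lemma lift_chartE (x y z : 'rV[R]_2) : 0 < dot y y ->
  (lift (chart (x, y, z))).2 =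
  (xy_norm (x, y))^-1 *: (z + (- (dot z y / dot y y)) *: y).
Proof.
move=> y0; have := xy_norm_gt0 (w := (x, y)) y0.
rewrite /lift /chart /=; move: (xy_norm _) => n /lt0r_neq0 n0.
move/lt0r_neq0: y0; rewrite dotZ !dotE => y0.
by apply: row2_eq; rewrite row2E /wedge !mxE; field; rewrite y0 n0.
Qed.

Lemma lift_chart_orbit rho1 rho2 : acts_freely (set_val rho1) ->
  coords (set_val rho2) = lift (chart (coords (set_val rho1))) ->
  same_orbit rho1 rho2.
Proof.
move=> free e; have y0 := free_dot free; apply/same_orbit_coords.
exists (- (dot (cz rho1) (cy rho1) / dot (cy rho1) (cy rho1))), 0,
  (xy_norm (cx rho1, cy rho1))^-1.
split; first by rewrite invr_gt0 xy_norm_gt0.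
- by rewrite /cx e.
- by rewrite /cy e.
by rewrite {1}/cz e scale0r subr0 -lift_chartE.
Qed.

Lemma free_orbit rho1 rho2 : same_orbit rho1 rho2 ->
  acts_freely (set_val rho1) -> acts_freely (set_val rho2).
Proof.
move=> /same_orbit_coords[a [b [t [t0 _ ey ez]]]] /acts_freelyP zy.
apply/acts_freelyP; rewrite ey ez wedge_shift; last exact: coords_commute.
by apply: mulf_neq0 => //; rewrite expf_neq0// gt_eqF.
Qed.

Lemma classU_eq rho1 rho2 : classU rho1 = classU rho2 <-> same_orbit rho1 rho2.
Proof.
split=> [/eqquotP/asboolP//|o].
by apply/eqquotP/asboolP.
Qed.

Lemma F_classU rho : F R (classU rho) <-> acts_freely (set_val rho).
Proof.
split=> [[rho' free /classU_eq o]|free]; first exact: free_orbit o free.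
by exists rho.
Qed.

Definition rep (p : U R) : @HomZ2 R := repr p.

Lemma repK p : classU (rep p) = p.
Proof. exact: reprK. Qed.

Lemma same_orbit_rep rho : same_orbit rho (rep (classU rho)).
Proof. by apply/classU_eq; rewrite repK. Qed.

Definition chartU (p : U R) := chart (coords (set_val (rep p))).

Lemma chartU_classU rho : chartU (classU rho) = chart (coords (set_val rho)).
Proof. exact/chart_orbit/same_orbit_rep. Qed.

Lemma holonomy_ex c : wedge c.1.1 c.1.2 = 0 ->
  exists rho : @HomZ2 R, set_val rho = holonomy c.
Proof. by move=> /holonomy_hom h; exact: set_val_ex h. Qed.

(** The lift of the chart provides a representative with normal coordinates, so
    [normal_form] has something to choose; whatever it chooses, [chart] takes the
    same value there and does not rescale its first two components. *)
Lemma bundle_proj_classU rho : acts_freely (set_val rho) ->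
  bundle_proj R (classU rho) = (chart (coords (set_val rho))).1.
Proof.
move=> free; set v := chart _.
have Bv : (T2 R `\` circS R) v.1.
  by apply: chart_slope; [exact: coords_commute|exact: free_dot].
have [rho' e'] : exists rho' : @HomZ2 R, set_val rho' = holonomy (lift v).
  by apply: holonomy_ex; case/circSCP: Bv => -[].
have c' : coords (set_val rho') = lift v by rewrite e' holonomy_coords.
have o : classU rho' = classU rho.
  exact/classU_eq/same_orbit_imp/lift_chart_orbit.
have /(xgetPex 0) : exists c, (@normal_coords R `&` [set coords (set_val r) |
    r in [set r : @HomZ2 R | classU r = classU rho]]) c.
  by exists (lift v); split; [exact: lift_normal|exists rho'].
rewrite -/(normal_form _) /bundle_proj => -[[Tc _ _] [rho2 /classU_eq cl e2]].
move: Tc; rewrite -e2 => Tc.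
by rewrite /v (chart_orbit cl) chart_normed.
Qed.

Lemma continuous_chart_for (Z : topologicalType) (s : Z) (x y z : Z -> 'rV[R]_2) :
  0 < dot (y s) (y s) ->
  continuous_at s x -> continuous_at s y -> continuous_at s z ->
  continuous_at s (fun s => chart (x s, y s, z s)).
Proof.
move=> y0 xC yC zC.
have rC : continuous_at s (fun s => (xy_norm (x s, y s))^-1).
  apply: continuous_inv_for; first by rewrite gt_eqF// xy_norm_gt0.
  by apply: continuous_sqrt_for; apply: continuous_add_for; exact: continuous_dot_for.
have wC : continuous_at s (fun s => wedge (z s) (y s)).
  exact: continuous_wedge_for.
apply: continuous_pair_for.
  by apply: continuous_pair_for; exact: continuous_scale_for.
by apply: continuous_mul_for => //; exact: continuous_mul_for.
Qed.

Lemma continuous_chart rho : acts_freely (set_val rho) ->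
  continuous_at rho (fun r : @HomZ2 R => chart (coords (set_val r))).
Proof.
move=> /free_dot y0.
exact: (continuous_chart_for (x := @cx R) (y := @cy R) (z := @cz R) y0
  (@continuous_cx R rho) (@continuous_cy R rho) (@continuous_cz R rho)).
Qed.

Lemma free_open rho : acts_freely (set_val rho) ->
  \forall r \near rho, acts_freely (set_val r).
Proof.
move=> /acts_freelyP zy.
have wC := continuous_wedge_for (f := @cz R) (g := @cy R)
  (@continuous_cz R rho) (@continuous_cy R rho).
have : nbhs (wedge (cz rho) (cy rho)) [set t | t != 0].
  by apply: open_nbhs_nbhs; split=> //; exact: open_neq.
move=> /wC N; apply: (@filterS _ (nbhs rho) _ _ _ _ N) => r zyr.
exact/acts_freelyP.
Qed.

Lemma chartU_continuous : continuous (fun p : F R => chartU (set_val p)).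
Proof.
rewrite -[X in continuous X]/(chartU \o set_val).
apply: quotient_continuous_on => rho /F_classU free; split.
  have := free_open free; apply: filterS => r fr; exact: (F_classU r).2.
suff : continuous_at rho (fun r => chartU (classU r)) by [].
rewrite (funext chartU_classU).
exact: continuous_chart.
Qed.

Lemma continuous_heis_for (Z : topologicalType) (z : Z) (f g h : Z -> R) :
  continuous_at z f -> continuous_at z g -> continuous_at z h ->
  continuous_at z (fun s => heis (f s) (g s) (h s)).
Proof.
move=> fC gC hC; apply: continuous_mx => -[[|[|[|//]]] ?] [[|[|[|//]]] ?];
  under eq_fun do rewrite mxE /=; by [|exact: continuous_cst_for].
Qed.

Lemma continuous_holonomy_for (Z : topologicalType) (z : Z) (f : Z -> R6 R) a :
  continuous_at z f -> continuous_at z (fun s => holonomy (f s) a).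
Proof.
move=> fC.
have lC (u : R6 R -> 'rV[R]_2) : continuous_at z (u \o f) ->
    continuous_at z (fun s => pencil (u (f s)) a.1%:~R a.2%:~R).
  by move=> uC; rewrite /pencil; continuity.
have xC := lC (fun c => c.1.1) (continuous_fst_for (continuous_fst_for fC)).
have yC := lC (fun c => c.1.2) (continuous_snd_for (continuous_fst_for fC)).
have zC := lC (fun c => c.2) (continuous_snd_for fC).
apply: continuous_heis_for => //; apply: continuous_add_for => //.
apply: continuous_mul_for; last exact: continuous_cst_for.
exact: continuous_mul_for.
Qed.

Lemma continuous_lift v : 0 < dot v.1.2 v.1.2 -> continuous_at v lift.
Proof.
move=> /lt0r_neq0 y0; rewrite /lift; continuity => //.
all: apply: continuous_dot_for; continuity.
Qed.

Lemma F_trivial_bundle :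
  trivial_bundle (F R) (bundle_proj R) (T2 R `\` circS R) (Rtimes R).
Proof.
have jE := embedding_pair (@embedding_set_val _ (T2 R `\` circS R))
  (@embedding_set_val _ (Rtimes R)).
set j := fun p => _ in jE.
have jC : continuous j by case: jE.
have jB b : (T2 R `\` circS R) (j b).1 by exact: set_val_in.
have /choice[h hE] : forall b, exists rho : @HomZ2 R, set_val rho = holonomy (lift (j b)).
  move=> b; apply: holonomy_ex.
  by case/circSCP: (jB b) => -[].
have hc b : coords (set_val (h b)) = lift (j b) by rewrite hE holonomy_coords.
have hfree b : acts_freely (set_val (h b)).
  apply/acts_freelyP; rewrite /cz /cy hc wedge_lift; first exact: (set_val_in b.2).
  by case/circSCP: (jB b).
have hC : continuous h.
  have [_ _] := @embedding_set_val _ (@HomZ2 R); apply.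
  apply: continuous_ptws => a b /=.
  rewrite (_ : (fun z => _) = fun b => holonomy (lift (j b)) a); last first.
    by apply/funext => b'; rewrite /= hE.
  have ljC : continuous_at (j b) lift.
    by apply: continuous_lift; case/circSCP: (jB b).
  exact: (continuous_holonomy_for (continuous_comp (jC b) ljC)).
have [|||phi [phiH phiE]] := homeomorphism_lift (f := fun p => chartU (set_val p))
    (g := fun b => classU (h b)) (@embedding_set_val _ (F R)) jE chartU_continuous.
- by move=> b; apply: (continuous_comp (hC b)); exact: pi_continuous.
- move=> p; case: (set_val_in p) => rho free <-; rewrite chartU_classU.
  set v := chart _.
  have Bv : (T2 R `\` circS R) v.1.
    by apply: chart_slope; [exact: coords_commute|exact: free_dot].
  have Av : Rtimes R v.2.
    by apply: chart_fibre; [exact: free_dot|exact/acts_freelyP].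
  have [b1 e1] := set_val_ex Bv; have [b2 e2] := set_val_ex Av.
  have jv : j (b1, b2) = v by rewrite /j /= e1 e2 -surjective_pairing.
  exists (b1, b2); split=> //.
  by apply/classU_eq/same_orbit_imp/lift_chart_orbit => //; rewrite hc jv.
- move=> b.
  have [p pE] : exists p : F R, set_val p = classU (h b).
    by apply: set_val_ex; apply/F_classU.
  by exists p; split=> //; rewrite pE chartU_classU hc chart_lift.
exists phi; split=> // p.
rewrite -[LHS]/((j (phi p)).1) phiE.
case: (set_val_in p) => rho free <-.
by rewrite chartU_classU bundle_proj_classU.
Qed.

(** The commutator with the matrix of coordinates (1, 0, 0) has y_i as its upper right
    entry. *)
Lemma center_cy rho i : Heis0_center (set_val rho (e2 i)) -> cy rho 0 i = 0.
Proof.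
move=> [_ /(_ _ (Heis0_heis 1 0 0))]; rewrite rep_coords !heisM.
by move=> /(congr1 (fun A : 'M_3 => A 0 2%:R)); rewrite !heis02; lra.
Qed.

Lemma F_sub_Ustar : F R `<=` Ustar R.
Proof.
move=> _ [rho free <-]; exists rho => //=; apply: contrapT => central.
have yi i : cy rho 0 i = 0.
  by apply: center_cy; apply: contrapT => nc; apply: central; exists (e2 i).
by have := free_dot free; rewrite dotE !yi mul0r addr0 ltxx.
Qed.

End Trivialization.

Theorem proposition82 (R : realType) :
  [/\ homeomorphic (T2 R) (circle R * circle R)%type,
      homeomorphic (circS R) (circle R),
      homeomorphic (T2 R `\` circS R) (circle R * R)%type,
      F R `<=` Ustar R
    & trivial_bundle (F R) (bundle_proj R) (T2 R `\` circS R) (Rtimes R)].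
Proof.
split.
- exact: T2_homeomorphic.
- exact: circS_homeomorphic.
- exact: cylinder_homeomorphic.
- exact: F_sub_Ustar.
- exact: F_trivial_bundle.
Qed.
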